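(* Let $A=\{v_1,\dots,v_k\}$ be a finite ordered subset of $\mathbb{Z}^n$, and let $\varphi$, $\pi$, $Z$, $\Phi$, the $\Phi$-strata of $\mathbb{R}^n/\varphi^{-1}(\mathbb{Z}^k)$, their lifts, and $J_S$ be as defined in the context. There is a bijection $S\mapsto p_S$ from the set of $\Phi$-strata of $\mathbb{R}^n/\varphi^{-1}(\mathbb{Z}^k)$ to the set $Z\cap\pi(\mathbb{Z}^k)$ of lattice points of $Z$ such that, writing $F_{p_S}$ for the minimal face of $Z$ containing $p_S$, the following hold. (1) $F_{p_S}$ is entirely determined by $J_S$: if $S,S'$ are $\Phi$-strata with $J_S=J_{S'}$, then $F_{p_S}=F_{p_{S'}}$. (2) The assignment is inclusion-reversing with respect to $J_S$: if $S,S'$ are $\Phi$-strata with $J_S\subseteq J_{S'}$, then $F_{p_{S'}}\subseteq F_{p_S}$. (3) For every $\Phi$-stratum $S$, every lift $\widetilde S$ of $S$ to $\mathbb{R}^n$ and every $u\in\widetilde S$, $$\dim F_{p_S}+\dim S = k-|J_S|+\dim\bigl(\ker\varphi\cap\mathrm{span}(\widetilde S-u)\bigr).$$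
   Context: Let $\langle\cdot,\cdot\rangle$ be the standard inner product on $\mathbb{R}^n$. Given $A=\{v_1,\dots,v_k\}\subset\mathbb{Z}^n$, define the linear map $\varphi:\mathbb{R}^n\to\mathbb{R}^k$ by $\varphi(u)_j=\langle u,v_j\rangle$, and let $\pi:\mathbb{R}^k\to\mathbb{R}^k/\mathrm{im}(\varphi)$ be its cokernel. The half-open zonotope is $Z=\pi([0,1)^k)$; its lattice points are the elements of $Z\cap\pi(\mathbb{Z}^k)$. The set $Z$ is convex. A face of a convex set $C$ is a convex subset $F\subseteq C$ such that whenever $x,y\in C$ and some point of the open segment between $x$ and $y$ lies in $F$, both $x,y\in F$. For $p\in Z$, the minimal face of $Z$ containing $p$ is the smallest face of $Z$ containing $p$. The dimension of a nonempty convex set is the dimension of its affine hull. Let $\varphi^{-1}(\mathbb{Z}^k)\subseteq\mathbb{R}^n$ be the subgroup of $u$ with $\varphi(u)\in\mathbb{Z}^k$, and let $h_j:\mathbb{R}^n/\varphi^{-1}(\mathbb{Z}^k)\to\mathbb{R}/\mathbb{Z}$ be the map induced by $\langle\cdot,v_j\rangle$. Let $\Phi:\mathbb{R}^n\to\mathbb{Z}^k$ be given by $\Phi(u)_j=\lceil\langle u,v_j\rangle\rceil$. For $c\in\mathbb{Z}^k$ let $\widetilde S_c=\Phi^{-1}(c)$ and let $S_c$ be the image of $\widetilde S_c$ in $\mathbb{R}^n/\varphi^{-1}(\mathbb{Z}^k)$. The nonempty sets $S_c$ are called the $\Phi$-strata; they partition $\mathbb{R}^n/\varphi^{-1}(\mathbb{Z}^k)$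 (different $c$ may give the same stratum). A lift of a $\Phi$-stratum $S$ is a set $\widetilde S_c$ whose image is $S$. For a $\Phi$-stratum $S$, set $J_S=\{j\in\{1,\dots,k\}: S\subseteq h_j^{-1}(0)\}$. The dimension $\dim S$ of a $\Phi$-stratum is the dimension of any lift, i.e. $\dim S=\dim\mathrm{span}(\widetilde S-u)$ for any lift $\widetilde S$ and any $u\in\widetilde S$. *)

(* Defs.v *)
From HB Require Import structures.
From mathcomp Require Import all_boot all_order all_algebra.
From mathcomp Require Import boolp classical_sets functions reals.
From mathcomp Require Import interval_inference convex.

Set Implicit Arguments.
Unset Strict Implicit.
Unset Printing Implicit Defensive.
Import Order.TTheory GRing.Theory Num.Theory.
Local Open Scope classical_set_scope.
Local Open Scope quotient_scope.
Local Open Scope ring_scope.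

(* The library's [Quotient.quot] equips the quotient of a zmodType by a
   subgroup with its group structure only; for a subspace, the vector space
   structure is added here. *)
Section VectorQuotient.
Variables (K : fieldType) (V : vectType K) (U : {vspace V}).

Definition vquot := Quotient.quot (pred_of_vspace U).
HB.instance Definition _ := GRing.Zmodule.on vquot.

Definition vquot_pi (x : V) : vquot := \pi_vquot x.
Let repr_q (q : vquot) : V := repr q.

Lemma vquot_eqP x y : reflect (vquot_pi x = vquot_pi y) (x - y \in U).
Proof. by rewrite (Quotient.idealrBE (pred_of_vspace U)); apply: eqP. Qed.

Let repr_qK : cancel repr_q vquot_pi.
Proof. exact: reprK. Qed.

Let repr_piB x : repr_q (vquot_pi x) - x \in U.
Proof. by apply/vquot_eqP; rewrite repr_qK. Qed.

Lemma vquot_piD : {morph vquot_pi : x y / x + y}.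
Proof. by move=> x y; rewrite /vquot_pi !piE. Qed.

Definition vquot_scale (a : K) (q : vquot) : vquot :=
  vquot_pi (a *: (repr q : V)).

Lemma vquot_piZ a x : vquot_pi (a *: x) = vquot_scale a (vquot_pi x).
Proof.
by apply/esym/vquot_eqP; rewrite -scalerBr memvZ //; exact: repr_piB.
Qed.

Let scaleA a b q : vquot_scale a (vquot_scale b q) = vquot_scale (a * b) q.
Proof. by rewrite -(repr_qK q) -!vquot_piZ scalerA. Qed.
Let scale1 : left_id 1 vquot_scale.
Proof. by move=> q; rewrite -(repr_qK q) -!vquot_piZ scale1r. Qed.
Let scaleDr : right_distributive vquot_scale +%R.
Proof.
move=> a q r; rewrite -(repr_qK q) -(repr_qK r).
by rewrite -vquot_piD -!vquot_piZ -vquot_piD scalerDr.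
Qed.
Let scaleDl q : {morph vquot_scale^~ q : a b / a + b}.
Proof.
by move=> a b; rewrite -(repr_qK q) -!vquot_piZ -vquot_piD scalerDl.
Qed.
HB.instance Definition _ :=
  GRing.Zmodule_isLmodule.Build K vquot scaleA scale1 scaleDr scaleDl.

Lemma vquot_pi_linear : linear vquot_pi.
Proof. by move=> a x y; rewrite vquot_piD vquot_piZ. Qed.
HB.instance Definition _ :=
  GRing.isLinear.Build K V vquot _ vquot_pi vquot_pi_linear.

Fact vquot_vect_iso : Vector.axiom (\dim (U^C)) vquot.
Proof.
pose f (x : V) := daddv_pi (U^C) U x.
have disj : (U^C :&: U = 0)%VS by rewrite capvC capv_compl.
have full x : x \in (U^C + U)%VS by rewrite addvC addv_complf memvf.
have fB x : x - f x \in U.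
  by rewrite -{1}(daddv_pi_add disj (full x)) addrC addKr memv_pi.
have fU x : x \in U -> f x = 0.
  move=> xU; have: f x \in (U^C :&: U)%VS.
    rewrite memv_cap memv_pi /=.
    by rewrite -[f x](subKr x) rpredB // fB.
  by rewrite disj memv0 => /eqP.
have [w w_lin w_bij] := subvs_vect_iso (U^C).
pose g (q : vquot) := w (vsproj (U^C) (f (repr_q q))).
have gpi x : g (vquot_pi x) = w (vsproj (U^C) (f x)).
  rewrite /g -[repr_q _](subrK x) [f (_ + x)]linearD /=.
  by rewrite [daddv_pi _ _ _]fU ?add0r.
exists g => [a q r|].
  rewrite -(repr_qK q) -(repr_qK r) -vquot_pi_linear !gpi -w_lin.
  by congr w; rewrite /f !linearP.
have [w' wK w'K] := w_bij.
exists (fun y => vquot_pi (vsval (w' y))) => [q|y].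
  rewrite /g wK vsprojK ?memv_pi // -[RHS]repr_qK.
  by apply/esym/vquot_eqP; rewrite fB.
by rewrite gpi /f daddv_pi_id // ?subvsP // vsvalK w'K.
Qed.
HB.instance Definition _ := Lmodule_hasFinDim.Build K vquot vquot_vect_iso.

End VectorQuotient.

Section Span.
Variables (K : fieldType) (V : vectType K).

Definition is_lspan (X : set V) (U : {vspace V}) :=
  X `<=` [set x | x \in U] /\
  forall W : {vspace V}, X `<=` [set x | x \in W] -> (U <= W)%VS.

(* The linear span of an arbitrary subset, as the least subspace containing
   it; the default value 0 is never used, by [lspanP]. *)
Definition lspan (X : set V) : {vspace V} := xget 0%VS (is_lspan X).

Lemma lspanP X : is_lspan X (lspan X).
Proof.
suff [U UX] : exists U, is_lspan X U by exact: (xgetPex _ (ex_intro _ U UX)).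
pose P n := `[< exists2 U : {vspace V}, \dim U = n &
  forall W : {vspace V}, X `<=` [set x | x \in W] -> (U <= W)%VS >].
have exP : exists n, P n.
  by exists 0; apply/asboolP; exists 0%VS; [exact: dimv0|move=> W _; exact: sub0v].
have ubP n : P n -> (n <= \dim {:V})%N.
  by move/asboolP => [U <- _]; exact/dimvS/subvf.
case: (ex_maxnP exP ubP) => m /asboolP[U dU UW] maxm; exists U; split => // x Xx.
apply: contrapT => /negP xU.
have /maxm : P (\dim (U + <[x]>)).
  apply/asboolP; exists (U + <[x]>)%VS => // W XW.
  by rewrite subv_add UW //= -memvE; exact: XW.
rewrite -dU => le; move/negP: xU; apply.
have /eqP -> : U == (U + <[x]>)%VS by rewrite eqEdim addvSl.
by rewrite memvE addvSr.
Qed.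

Definition affine_set (X : set V) :=
  forall (t : K) x y, X x -> X y -> X ((1 - t) *: x + t *: y).

Definition affine_hull (X : set V) : set V := smallest affine_set X.

(* The dimension of an affine subspace is that of its direction. *)
Definition affine_dim (X : set V) : nat :=
  let H := affine_hull X in
  \dim (lspan [set z | exists x y, [/\ H x, H y & z = x - y]]).

End Span.

Section Faces.
Variables (R : realType) (E : lmodType R).

Definition is_face (C F : set E) :=
  [/\ convex_set (F : set (convex_lmodType E)), F `<=` C &
      forall (x y : E) (t : R), C x -> C y -> 0 < t < 1 ->
        F ((1 - t) *: x + t *: y) -> F x /\ F y].

(* An intersection of faces is a face, and a convex C is a face of itself: for
   p in C this intersection of the faces through p is the smallest one. *)
Definition minimal_face (C : set E) (p : E) : set E :=
  smallest (is_face C) [set p].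

End Faces.

Section Zonotope.
Variables (R : realType) (n k : nat) (v : 'I_k -> 'rV[int]_n).

Definition pairing (u : 'rV[R]_n) (w : 'rV[int]_n) : R :=
  \sum_(i < n) u 0 i * (w 0 i)%:~R.

Definition phi_fun (u : 'rV[R]_n) : 'rV[R]_k := \row_j pairing u (v j).

Fact phi_fun_linear : linear phi_fun.
Proof.
move=> a x y; apply/rowP => j; rewrite !mxE /pairing mulr_sumr -big_split /=.
by apply: eq_bigr => i _; rewrite !mxE mulrDl mulrA.
Qed.
HB.instance Definition _ :=
  GRing.isLinear.Build R 'rV[R]_n 'rV[R]_k _ phi_fun phi_fun_linear.

Definition phi : 'Hom('rV[R]_n, 'rV[R]_k) := linfun phi_fun.

Lemma phiE u j : phi u 0 j = pairing u (v j).
Proof. by rewrite lfunE /= mxE. Qed.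

Definition coker : vectType R := vquot (limg phi).
Definition cokpi : 'rV[R]_k -> coker := @vquot_pi _ _ (limg phi).

Definition zonotope : set coker :=
  cokpi @` [set x : 'rV[R]_k | forall j, 0 <= x 0 j < 1].

Definition lattice_points : set coker :=
  zonotope `&` cokpi @` [set x : 'rV[R]_k | forall j, x 0 j \is a Num.int].

Definition Lambda : {pred 'rV[R]_n} := fun u =>
  [forall j, phi u 0 j \is a Num.int].

Fact Lambda_zmod_closed : zmod_closed Lambda.
Proof.
split=> [|x y].
  by apply/forallP => j; rewrite linear0 mxE rpred0.
move=> /forallP xL /forallP yL; apply/forallP => j.
by rewrite linearB !mxE rpredB.
Qed.
HB.instance Definition _ := GRing.isZmodClosed.Build _ Lambda Lambda_zmod_closed.

Definition torus := @Quotient.quot 'rV[R]_n Lambda.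
Definition torus_pi (u : 'rV[R]_n) : torus := \pi_torus u.

(* [x \is a Num.int] is by definition membership in [Num.int_num_subdef]. *)
Definition RmodZ := @Quotient.quot R (Num.int_num_subdef : {pred R}).

(* Independent of the representative, see [hE]. *)
Definition h (j : 'I_k) (q : torus) : RmodZ :=
  \pi_RmodZ (pairing (repr q) (v j)).

Lemma hE j u : h j (torus_pi u) = \pi_RmodZ (pairing u (v j)).
Proof.
apply/eqP; rewrite -(Quotient.idealrBE (Num.int_num_subdef : {pred R})).
have: Lambda (repr (torus_pi u) - u).
  rewrite -[Lambda _]/((_ - _) \in Lambda) (Quotient.idealrBE Lambda).
  by apply/eqP; exact: reprK.
rewrite /Lambda linearB /= => /forallP/(_ j).
by rewrite !mxE -!phiE.
Qed.

Definition Phi (u : 'rV[R]_n) : 'rV[int]_k :=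
  \row_j Num.ceil (pairing u (v j)).

Definition Phi_fiber (c : 'rV[int]_k) : set 'rV[R]_n := Phi @^-1` [set c].

Definition strata : set (set torus) :=
  [set S | S !=set0 /\ exists c, S = torus_pi @` Phi_fiber c].

Definition is_lift (S : set torus) (L : set 'rV[R]_n) :=
  exists2 c, L = Phi_fiber c & torus_pi @` L = S.

Definition J (S : set torus) : {set 'I_k} :=
  [set j | `[< S `<=` h j @^-1` [set 0] >]].

Definition span_at (L : set 'rV[R]_n) (u : 'rV[R]_n) : {vspace 'rV[R]_n} :=
  lspan [set x - u | x in L].

(* The value does not depend on the lift or on the point, see
   [stratum_dimE]. *)
Definition stratum_dim (S : set torus) : nat :=
  xget 0 [set d | exists L u, [/\ is_lift S L, L u & d = \dim (span_at L u)]].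

Fact span_at_sub L u u' : L u -> (span_at L u <= span_at L u')%VS.
Proof.
move=> Lu; apply: (lspanP _).2 => _ [x Lx <-] /=.
rewrite -(subrKA u') -[u' - u]opprB rpredB //.
  by apply: (lspanP _).1; exists x.
by apply: (lspanP _).1; exists u.
Qed.

Fact span_at_indep L u u' : L u -> L u' -> span_at L u = span_at L u'.
Proof. by move=> Lu Lu'; apply: subv_anti; rewrite !span_at_sub. Qed.

Fact Phi_shift x l : Lambda l -> forall j,
  Phi (x + l) 0 j = Phi x 0 j + Num.ceil (pairing l (v j)).
Proof.
move=> /forallP Ll j; rewrite !mxE -!phiE linearD /= mxE.
by rewrite ceilDrz.
Qed.

Fact span_at_lift S L L' u u' : is_lift S L -> is_lift S L' -> L u -> L' u' ->
  span_at L u = span_at L' u'.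
Proof.
move=> [c -> cS] [c' -> c'S] Lu Lu'.
have [y Ly yu] : (torus_pi @` Phi_fiber c') (torus_pi u).
  by rewrite c'S -cS; exists u.
have Ll : Lambda (y - u).
  change (y - u \in Lambda); rewrite (Quotient.idealrBE Lambda).
  exact/eqP.
have uy : u + (y - u) = y by rewrite addrC subrK.
have shift x : Phi_fiber c x <-> Phi_fiber c' (x + (y - u)).
  have -> : c' = Phi (u + (y - u)) by rewrite uy Ly.
  rewrite /Phi_fiber /= -Lu; split => [e|e]; apply/rowP => j.
    by rewrite !Phi_shift // e.
  by move/rowP/(_ j) : e; rewrite !Phi_shift // => /addIr.
rewrite (span_at_indep Lu' Ly) /span_at; congr lspan.
apply/seteqP; split => _ [x Lx <-].
  by exists (x + (y - u)); [exact/shift|rewrite addrA addrAC addrK].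
by exists (x - (y - u)); [apply/shift; rewrite subrK|rewrite opprB addrA addrAC addrK].
Qed.

Lemma stratum_dimE S L u :
  is_lift S L -> L u -> stratum_dim S = \dim (span_at L u).
Proof.
move=> SL Lu; rewrite /stratum_dim.
apply: xget_unique; first by exists L, u.
by move=> _ [L' [u' [SL' Lu' ->]]]; rewrite (span_at_lift SL' SL Lu' Lu).
Qed.

End Zonotope.

Arguments zonotope R {n k} v _.
Arguments lattice_points R {n k} v _.
Arguments strata R {n k} v _.

(* Main.v *)
Require Import Defs.
From mathcomp Require Import all_boot all_order all_algebra.
From mathcomp Require Import boolp classical_sets functions reals.
From mathcomp Require Import interval_inference ring lra.

(** The map sends the stratum [S] of a lift [L = Phi^-1(c)] to [p_S = pi(c)].

    By definition of the ceiling, [u] lies in [Phi^-1(c)] exactly when the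
    vector [c - phi(u)] lies in the half-open cube ([fiberP]).  As [u] varies,
    [c - phi(u)] runs over the coset [c + im phi], so the lift of [S] is an
    affine parametrisation of the fibre of [pi] over [p_S] inside the cube.
    Hence [p_S] is a lattice point of [Z]; every lattice point [pi(z)], [z]
    integral, arises by taking [c = z]; and two integer vectors [c], [c'] have
    the same image under [pi] exactly when they differ by [phi(l)] with
    [phi(l)] integral, that is, when the fibres of [Phi] over them are
    translates of each other by an element of the lattice [phi^-1(Z^k)]
    ([stratum_eqP]).

    In the same dictionary, [j] belongs to [J_S] exactly when the [j]-th
    coordinate vanishes on the whole fibre over [p_S] ([mem_J]).  The
    coordinates are nonnegative there, so taking midpoints yields one point [q]
    of the fibre whose coordinates outside [J_S] are all positive
    ([fiber_relint]).  Let [W] be the space of vectors vanishing on [J_S] and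
    [Q] the set of points of the cube in [W].  Since the upper faces of the
    cube are missing, [q] can be moved a little in every direction of [W]
    without leaving [Q] ([cube_face_absorbing]), and everything follows.

    - The minimal face through [p_S] is [pi(Q)] ([minimal_face_stratum]), which
      depends on [J_S] only, and in a decreasing way.
    - Its dimension is that of [pi(W)], namely
      [k - |J_S| - dim(W cap im phi)] ([affine_dim_cube_face]).
    - The directions of the lift span [phi^-1(W)] ([span_fiber]), whose
      dimension is [dim(W cap im phi)] plus that of its part in [ker phi].

    Adding the last two equalities gives the dimension formula. *)

Import Order.TTheory GRing.Theory Num.Theory.
Local Open Scope classical_set_scope.
Local Open Scope quotient_scope.
Local Open Scope ring_scope.

Set Implicit Arguments.
Unset Strict Implicit.

(** * Spans and affine hulls of sets with an absorbing point *)

Section Absorbing.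
Variables (K : fieldType) (V : vectType K).

(** A set of vectors that contains a nonzero multiple of every vector of [U]
    spans [U]: this computes the span of a set which is merely open in [U]. *)
Lemma lspan_absorbing (X : set V) (U : {vspace V}) :
  X `<=` [set x | x \in U] ->
  (forall w, w \in U -> exists2 e : K, e != 0 & X (e *: w)) ->
  lspan X = U.
Proof.
move=> XU absX; have [Xspan minspan] := lspanP X.
apply: subv_anti; rewrite minspan //=; apply/subvP => w /absX[e e0 Xew].
by have := Xspan _ Xew; rewrite /= rpredZeq (negPf e0).
Qed.

(** Affine counterpart of [lspan_absorbing]: [x0] plays the part of a relative
    interior point, and [U] that of the direction of the affine hull. *)
Lemma affine_dim_absorbing (X : set V) x0 (U : {vspace V}) :
  (forall x, X x -> x - x0 \in U) ->
  (forall w, w \in U -> exists2 e : K, e != 0 & X (x0 + e *: w)) ->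
  affine_dim X = \dim U.
Proof.
move=> XU absX.
(* The coset x0 + U is affine, hence contains the affine hull. *)
have hullU : affine_hull X `<=` [set x | x - x0 \in U].
  apply: smallest_sub => // t x y /= xU yU.
  have -> : (1 - t) *: x + t *: y - x0 = (1 - t) *: (x - x0) + t *: (y - x0).
    rewrite !scalerBr addrACA -opprD -scalerDl subrK scale1r //.
  by rewrite rpredD // rpredZ.
have subX : X `<=` affine_hull X by exact: sub_smallest.
rewrite /affine_dim (@lspan_absorbing _ U) //.
  move=> _ [x [y [/hullU/= xU /hullU/= yU ->]]] /=.
  by rewrite -(subrKA x0) -[x0 - y]opprB rpredB.
move=> w /absX[e e0 Xe]; exists e => //.
exists (x0 + e *: w), x0; split; first exact: subX.
  by have [e' _] := absX 0 (mem0v _); rewrite scaler0 addr0 => /subX.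
by rewrite addrC addKr.
Qed.

End Absorbing.

(** * Minimal faces *)

(** When [p] is a relative interior point of the face [F], every point of [F]
    is the end of an open segment inside [F] through [p]; a face containing [p]
    must then contain that end. *)
Lemma minimal_face_relint (R : realType) (E : lmodType R) (C F : set E) p :
  is_face C F -> F p ->
  (forall q, F q -> exists r t,
     [/\ F r, 0 < t < 1 & p = (1 - t) *: q + t *: r]) ->
  minimal_face C p = F.
Proof.
move=> faceF Fp relint; apply/seteqP; split.
  by apply: smallest_sub => // _ ->.
have [_ FC _] := faceF.
move=> q Fq G [[_ _ faceG] Gp].
have [r [t [Fr t01 pE]]] := relint q Fq.
have [] // : G q /\ G r.
by apply: faceG t01 _; [exact: FC|exact: FC|rewrite -pE; exact: Gp].
Qed.

(** * The half-open cube and its coordinate faces *)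

Section Cube.
Variables (R : realType) (k : nat).
Implicit Types (I : {set 'I_k}) (x y q w : 'rV[R]_k).

Definition cube : set 'rV[R]_k := [set x | forall j, 0 <= x 0 j < 1].

(** The vectors vanishing on [I], as the kernel of the restriction to the
    coordinates in [I]; that restriction is onto, which gives the dimension. *)
Definition coord_space I : {vspace 'rV[R]_k} :=
  lker (linfun (colsub (@enum_val _ (mem I)) : 'rV[R]_k -> 'rV[R]_#|I|)).

Lemma coord_spaceP I x :
  reflect (forall j, j \in I -> x 0 j = 0) (x \in coord_space I).
Proof.
rewrite memv_ker lfunE /=; apply: (iffP eqP) => [x0 j jI|x0].
  by have /rowP/(_ (enum_rank_in jI j)) := x0; rewrite !mxE enum_rankK_in.
by apply/rowP => i; rewrite !mxE x0 ?enum_valP.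
Qed.

Lemma dim_coord_space I : \dim (coord_space I) = (k - #|I|)%N.
Proof.
rewrite /coord_space; set f := linfun _.
have f_surj : limg f = fullv.
  apply/vspaceP => y; rewrite memvf.
  apply/memv_imgP; exists (\row_j \sum_(i | enum_val i == j) y 0 i).
    exact: memvf.
  rewrite lfunE /=; apply/rowP => i; rewrite !mxE.
  by rewrite (big_pred1 i) // => i'; rewrite (inj_eq enum_val_inj).
have := limg_ker_dim f fullv; rewrite f_surj capfv !dimvf !dim_matrix !mul1r.
by move=> dimE; rewrite -[LHS](addnK #|I|) [X in (X - _)%N]dimE.
Qed.

Definition cube_face I : set 'rV[R]_k :=
  cube `&` [set x | x \in coord_space I].

Lemma cube_convex x y (t : R) :
  0 <= t <= 1 -> cube x -> cube y -> cube ((1 - t) *: x + t *: y).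
Proof.
move=> /andP[t0 t1] x01 y01 j; rewrite !mxE.
have /andP[x0 x1] := x01 j; have /andP[y0 y1] := y01 j.
apply/andP; split; first by nra.
by have [xy|yx] := leP (x 0 j) (y 0 j); nra.
Qed.

Lemma cube_face_convex I x y (t : R) :
  0 <= t <= 1 -> cube_face I x -> cube_face I y ->
  cube_face I ((1 - t) *: x + t *: y).
Proof.
move=> t01 [x01 xI] [y01 yI]; split; first exact: cube_convex.
by rewrite /= rpredD // rpredZ.
Qed.

(** Of the inequalities [0 <= x_j < 1] with [j] outside [I], only the left ones
    could be equalities at a point of the face; if they are strict at [q], then
    [q] is a relative interior point. *)
Lemma cube_face_absorbing I q w :
  cube_face I q -> (forall j, j \notin I -> 0 < q 0 j) ->
  w \in coord_space I -> exists2 e : R, 0 < e & cube_face I (q + e *: w).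
Proof.
move=> [q01 qI] q_gt0 wI.
(* Along w, coordinate j stays in ]0, 1[ up to the step d j. *)
pose d j := Num.min (q 0 j) (1 - q 0 j) / (1 + `|w 0 j|).
pose e := \big[Num.min/1]_(j | j \notin I) d j.
have w1_gt0 j : 0 < 1 + `|w 0 j| by rewrite ltr_pwDl.
have e_gt0 : 0 < e.
  apply: lt_bigmin => // j jI; apply: divr_gt0 => //.
  by rewrite lt_min q_gt0 //= subr_gt0; have /andP[] := q01 j.
exists e => //; split; last by rewrite /= rpredD // rpredZ.
move=> j; rewrite !mxE; have [jI|jI] := boolP (j \in I).
  have /coord_spaceP/(_ j jI) -> := wI.
  by rewrite mulr0 addr0; exact: q01.
have: e <= d j by exact: bigmin_le_cond.
rewrite ler_pdivlMr // le_min => /andP[eq eq1].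
have ew : `|e * w 0 j| < e * (1 + `|w 0 j|).
  by rewrite normrM gtr0_norm // ltr_pM2l // ltrDr.
by move: ew; rewrite ltr_norml => /andP[ew1 ew2]; apply/andP; split; lra.
Qed.

(** The midpoint of two nonnegative vectors is positive wherever one of them is,
    so that finitely many midpoints collect all the positive coordinates. *)
Lemma midpoint_gt0 (X : set 'rV[R]_k) :
  X !=set0 -> (forall x j, X x -> 0 <= x 0 j) ->
  (forall x y, X x -> X y -> X (2^-1 *: (x + y))) ->
  exists2 x, X x & forall j y, X y -> 0 < y 0 j -> 0 < x 0 j.
Proof.
move=> [x0 Xx0] X_ge0 Xmid.
suff [x Xx xP] : exists2 x, X x &
    forall j y, j \in enum 'I_k -> X y -> 0 < y 0 j -> 0 < x 0 j.
  by exists x => // j y; apply: xP; rewrite mem_enum.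
elim: (enum _) => [|i s [x Xx xs]]; first by exists x0.
have [[z Xz zi]|no_z] := pselect (exists2 z, X z & 0 < z 0 i); last first.
  exists x => // j y; rewrite inE => /predU1P[->|js] Xy yj; last exact: xs yj.
  by case: no_z; exists y.
exists (2^-1 *: (x + z)); first exact: Xmid.
move=> j y; rewrite inE !mxE => js Xy yj.
rewrite mulr_gt0 ?invr_gt0 //.
case/predU1P: js => [->|js]; first by rewrite ltr_wpDl // X_ge0.
by rewrite ltr_pwDl // ?X_ge0 //; exact: xs yj.
Qed.

End Cube.

(** * Strata as fibres of the projection of the cube *)

Section Strata.
Variables (R : realType) (n k : nat) (v : 'I_k -> 'rV[int]_n).
Implicit Types (c : 'rV[int]_k) (u l : 'rV[R]_n) (S : set (torus R v)).

Local Notation intv c := (map_mx intr c : 'rV[R]_k).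
Local Notation fiber := (@Phi_fiber R n k v).
Local Notation stratum c := (torus_pi v @` fiber c).
Local Notation phi := (phi R v).
Local Notation cok := (@cokpi R n k v).

Lemma cokpi_comb (a b : R) x y :
  cok (a *: x + b *: y) = a *: cok x + b *: cok y.
Proof. by rewrite /cokpi linearD !linearZ. Qed.

Lemma cok_eqP x y : cok x = cok y <-> exists u, x = y + phi u.
Proof.
split=> [/vquot_eqP/memv_imgP[u _ xy]|[u ->]].
  by exists u; rewrite -xy addrC subrK.
by apply/vquot_eqP; rewrite addrC addKr memv_img ?memvf.
Qed.

Lemma torus_pi_eqP u u' : torus_pi v u = torus_pi v u' <-> Lambda v (u - u').
Proof.
rewrite -[Lambda _ _]/(_ \in Lambda v) (Quotient.idealrBE (@Lambda R n k v)).
by split=> [uu'|/eqP//]; apply/eqP.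
Qed.

(** The dictionary between both sides: the fractional defects [c - phi u] of
    the points of a lift are the points of the cube over [pi(c)]. *)
Lemma fiberP c u : fiber c u <-> cube (intv c - phi u).
Proof.
split=> [<- j|cu].
  rewrite !mxE phiE; have /andP[] := ceil_itv (pairing u (v j)).
  by rewrite intrB => lt le; apply/andP; split; lra.
apply/rowP => j; rewrite !mxE; apply: ceil_def.
have := cu j; rewrite !mxE phiE => /andP[ge lt].
by rewrite intrB; apply/andP; split; lra.
Qed.

(** On [Phi^-1(c)], the [j]-th pairing is an integer exactly when it equals its
    ceiling [c_j]. *)
Lemma mem_J c j :
  j \in J (stratum c) <-> forall u, fiber c u -> (intv c - phi u) 0 j = 0.
Proof.
have hj0 u : h j (torus_pi v u) = 0 <-> pairing u (v j) \is a Num.int.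
  have -> : 0 = \pi_(RmodZ R) 0 :> RmodZ R by rewrite !piE.
  rewrite hE -[X in X \is a _]subr0.
  rewrite -[_ \is a _]/(_ \in (Num.int_num_subdef : {pred R})).
  rewrite (Quotient.idealrBE (Num.int_num_subdef : {pred R})).
  by split=> [uu'|/eqP//]; apply/eqP.
have slack0 u : fiber c u ->
    (pairing u (v j) \is a Num.int) = ((intv c - phi u) 0 j == 0).
  by move=> <-; rewrite intrEceil !mxE phiE subr_eq0.
rewrite inE; split=> [/asboolP Sh u cu|slackJ].
  by apply/eqP; rewrite -slack0 //; apply/hj0/Sh; exists u.
apply/asboolP => _ [u cu <-] /=; apply/hj0.
by rewrite slack0 // slackJ.
Qed.

Lemma fiber_cube_face c u :
  fiber c u -> cube_face (J (stratum c)) (intv c - phi u).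
Proof.
move=> cu; split; first exact/fiberP.
by apply/coord_spaceP => j /mem_J; apply.
Qed.

(** The fibre of [pi] over [pi(c)] in the cube is convex, and by [mem_J] every
    coordinate outside [J] is positive somewhere on it. *)
Lemma fiber_relint c : fiber c !=set0 ->
  exists2 u, fiber c u &
    forall j, j \notin J (stratum c) -> 0 < (intv c - phi u) 0 j.
Proof.
move=> [u0 cu0].
have [_ [u cu <-] u_gt0] : exists2 x, [set intv c - phi u | u in fiber c] x &
    forall j y, [set intv c - phi u | u in fiber c] y -> 0 < y 0 j ->
      0 < x 0 j.
  apply: midpoint_gt0; first by exists (intv c - phi u0), u0.
    by move=> _ j [u /fiberP/(_ j)/andP[ge _] <-].
  move=> _ _ [x cx <-] [y cy <-]; exists (2^-1 *: (x + y)).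
    apply/fiberP => j.
    have /fiberP/(_ j)/andP[x0 x1] := cx.
    have /fiberP/(_ j)/andP[y0 y1] := cy.
    move: x0 x1 y0 y1; rewrite linearZ linearD !mxE => x0 x1 y0 y1.
    by apply/andP; split; lra.
  by rewrite linearZ linearD; apply/rowP => j; rewrite !mxE; field.
exists u => // j /negP jJ; apply: contrapT => /negP.
rewrite -leNgt => uj; apply: jJ; apply/mem_J => y cy.
apply/eqP; rewrite eq_le; apply/andP; split; last first.
  by have /fiberP/(_ j)/andP[] := cy.
rewrite leNgt; apply/negP => yj; move: uj; rewrite leNgt => /negP; apply.
by apply: u_gt0 yj; exists y.
Qed.

(** * The minimal face of the lattice point of a stratum *)

(** That [pi(Q)] is a face, where [Q] is the face of the cube cut out by [J],
    rests on the fact that every point of the cube over [pi(c)] lies in [Q].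
    Suppose that a segment [[a, b]] of the cube has an interior point over
    [pi(z)], with [z] in [Q].  Mixing that point with the end [r] of a segment
    of [Q] that starts at [z] and has [q] in its interior gives a point of the
    cube over [pi(q) = pi(c)]; its coordinates in [J] vanish, and since they
    are combinations of nonnegative terms with positive weights, so do those of
    [a] and [b]. *)
Lemma minimal_face_stratum c : fiber c !=set0 ->
  minimal_face (zonotope R v) (cok (intv c)) = cok @` cube_face (J (stratum c)).
Proof.
move=> c0; have [u cu u_gt0] := fiber_relint c0.
set I := J _ in u_gt0 *; pose q := intv c - phi u.
have qI : cube_face I q by exact: fiber_cube_face.
have cokq : cok q = cok (intv c).
  by apply/cok_eqP; exists (- u); rewrite linearN.
have relint x : cube_face I x -> exists y (t : R),
    [/\ cube_face I y, 0 < t < 1 & q = (1 - t) *: x + t *: y].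
  move=> xI; have xqI : q - x \in coord_space R I.
    by rewrite rpredB //; [exact: qI.2|exact: xI.2].
  have [e e0 yI] := cube_face_absorbing qI u_gt0 xqI.
  (* Prolong the segment from x to q beyond q by the ratio e. *)
  exists (q + e *: (q - x)), (1 + e)^-1; split=> //.
    by rewrite invr_gt0 addr_gt0 //= invf_lt1 ?ltrDl // addr_gt0.
  apply/rowP => j; rewrite !mxE; field.
  by rewrite gt_eqF // addr_gt0.
have fiberI x : cube x -> cok x = cok (intv c) -> cube_face I x.
  move=> x0 /cok_eqP[w xE]; have -> : x = intv c - phi (- w).
    by rewrite linearN opprK.
  by apply/fiber_cube_face/fiberP; rewrite linearN opprK -xE.
apply: minimal_face_relint.
- split=> [x y t /[!inE]|_ [x xI <-]|x y t].
  + move=> [a aI <-] [b bI <-].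
    (* Here t is the weight of the first point, not of the second. *)
    exists ((1 - (1 - t%:num)) *: a + (1 - t%:num) *: b).
      by apply: cube_face_convex => //; rewrite subr_ge0 gerBl ge0 le1.
    by rewrite cokpi_comb subKr.
  + by exists x => //; exact: xI.1.
  + move=> [a a0 <-] [b b0 <-] t01 [z zI] zE.
    have [r [s [rI s01 qE]]] := relint z zI.
    have [t0 t1] := andP t01; have [s0 s1] := andP s01.
    pose m := (1 - t) *: a + t *: b.
    have m0 : cube m by apply: cube_convex; rewrite ?ltW.
    have mI : cube_face I ((1 - s) *: m + s *: r).
      apply: fiberI; first by apply: cube_convex rI.1; rewrite ?ltW.
      by rewrite -cokq qE !cokpi_comb zE.
    have ab0 j : j \in I -> a 0 j = 0 /\ b 0 j = 0.
      move=> jI; have /coord_spaceP/(_ j jI) := mI.2; rewrite !mxE.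
      have /coord_spaceP/(_ j jI) -> := rI.2.
      rewrite mulr0 addr0 => /eqP; rewrite mulf_eq0 subr_eq0 (gt_eqF s1) /=.
      have /andP[aj _] := a0 j; have /andP[bj _] := b0 j.
      rewrite paddr_eq0; [|by rewrite mulr_ge0 // subr_ge0 ltW
                          |by rewrite mulr_ge0 // ltW].
      rewrite !mulf_eq0 subr_eq0 (gt_eqF t1) (gt_eqF t0) /=.
      by case/andP => /eqP-> /eqP->.
    split; [exists a|exists b] => //; split=> //;
      by apply/coord_spaceP => j /ab0[].
- by exists q.
- move=> _ [x xI <-]; have [y [t [yI t01 qE]]] := relint x xI.
  exists (cok y), t; split=> //.
  by rewrite -cokq {1}qE cokpi_comb.
Qed.

(** * The bijection between strata and lattice points *)

Lemma fiber_translate c c' u l :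
  intv c = intv c' + phi l -> fiber c (u + l) <-> fiber c' u.
Proof.
by move=> cE; rewrite !fiberP cE linearD opprD addrACA subrr addr0.
Qed.

(** A stratum determines [c] up to [phi(l)] with [phi(l)] integral, because
    ceilings commute with integer translations. *)
Lemma stratum_eqP c c' : fiber c !=set0 ->
  stratum c = stratum c' <-> cok (intv c) = cok (intv c').
Proof.
move=> [u cu]; split=> [cc'|/cok_eqP[l cE]].
  have [u' c'u' /esym/torus_pi_eqP uu'] : stratum c' (torus_pi v u).
    by rewrite -cc'; exists u.
  apply/cok_eqP; exists (u - u'); rewrite -cu -c'u' -{1}(subrKC u' u).
  apply/rowP => j; rewrite mxE Phi_shift // intrD !mxE !phiE; congr (_ + _).
  by have /forallP/(_ j) := uu'; rewrite phiE => /ceilK.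
have torusD x : torus_pi v (x + l) = torus_pi v x.
  apply/torus_pi_eqP; rewrite addrC addKr; apply/forallP => j.
  have /rowP/(_ j) := cE; rewrite !mxE => /eqP.
  rewrite addrC -subr_eq => /eqP <-.
  by rewrite rpredB // intr_int.
apply/seteqP; split=> _ [x cx <-].
  exists (x - l); last by rewrite -[in RHS](subrK l x) torusD.
  by apply: (fiber_translate _ cE).1; rewrite subrK.
by exists (x + l); [exact: (fiber_translate _ cE).2|rewrite torusD].
Qed.

(** The common value of [pi(c)] over all the [c] whose fibre is a lift of [S];
    see [stratum_pointE]. *)
Definition stratum_point S : coker R v :=
  xget 0 [set q | exists2 c, S = stratum c & q = cok (intv c)].

Lemma stratum_pointE c :
  fiber c !=set0 -> stratum_point (stratum c) = cok (intv c).
Proof.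
move=> c0; apply: xget_unique; first by exists c.
by move=> _ [c' cc' ->]; apply/esym/stratum_eqP.
Qed.

Lemma strataP S : strata R v S -> exists2 c, fiber c !=set0 & S = stratum c.
Proof.
move=> [[q Sq] [c SE]]; exists c => //.
by move: Sq; rewrite SE => -[u cu _]; exists u.
Qed.

Lemma stratum_point_bij :
  set_bij (strata R v) (lattice_points R v) stratum_point.
Proof.
split.
- move=> S /strataP[c c0 SE]; rewrite /= SE stratum_pointE //; split; last first.
    by exists (intv c) => // j; rewrite mxE intr_int.
  have [u /fiberP cu] := c0; exists (intv c - phi u) => //.
  by apply/cok_eqP; exists (- u); rewrite linearN.
- move=> S S' /[!inE] /strataP[c c0 ->] /strataP[c' c'0 ->].
  by rewrite !stratum_pointE // => /stratum_eqP; apply.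
- move=> q [[x x01 xq] [z zZ zq]]; rewrite -zq.
  have /cok_eqP[u zE] : cok z = cok x by rewrite xq zq.
  pose c : 'rV[int]_k := \row_j Num.ceil (z 0 j).
  have cz : intv c = z by apply/rowP => j; rewrite !mxE ceilK.
  have c0 : fiber c !=set0.
    by exists u; apply/fiberP; rewrite cz zE addrK.
  exists (stratum c).
    split; last by exists c.
    by have [y cy] := c0; exists (torus_pi v y), y.
  by rewrite stratum_pointE // cz.
Qed.

Lemma minimal_face_stratum_point S : strata R v S ->
  minimal_face (zonotope R v) (stratum_point S) = cok @` cube_face (J S).
Proof.
by move=> /strataP[c c0 ->]; rewrite stratum_pointE // minimal_face_stratum.
Qed.

(** * The dimension formula *)

(** At the point [y] of [fiber_relint], moving by a small multiple of [w]
    changes [c - phi(y)] by one of [- phi(w)], which stays in the face of the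
    cube when [phi(w)] vanishes on [J]. *)
Lemma span_fiber c u : fiber c u ->
  span_at (fiber c) u = (phi @^-1: coord_space R (J (stratum c)))%VS.
Proof.
move=> cu; have [|y cy y_gt0] := @fiber_relint c; first by exists u.
rewrite (span_at_indep cu cy); apply: lspan_absorbing.
  move=> _ [x cx <-]; rewrite /= -memv_preim.
  have -> : phi (x - y) = (intv c - phi y) - (intv c - phi x).
    by rewrite linearB opprB [RHS]addrC addrA subrK.
  by rewrite rpredB //; [exact: (fiber_cube_face cy).2
                        |exact: (fiber_cube_face cx).2].
move=> w; rewrite -memv_preim -rpredN => wI.
have [e e0 eI] := cube_face_absorbing (fiber_cube_face cy) y_gt0 wI.
exists e; first by rewrite gt_eqF.
exists (y + e *: w); last by rewrite addrC addKr.
by apply/fiberP; move: eI.1; rewrite linearD linearZ opprD addrA scalerN.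
Qed.

Lemma affine_dim_cube_face c : fiber c !=set0 ->
  affine_dim (cok @` cube_face (J (stratum c))) =
  \dim (linfun cok @: coord_space R (J (stratum c))).
Proof.
move=> /fiber_relint[u cu u_gt0].
have qI := fiber_cube_face cu; set q := _ - _ in u_gt0 qI.
apply: (@affine_dim_absorbing _ _ _ (cok q)) => [_ [x xI <-]|].
  apply/memv_imgP; exists (x - q); last first.
    by rewrite lfunE /= /cokpi [in RHS]linearB.
  by rewrite rpredB //; [exact: xI.2|exact: qI.2].
move=> _ /memv_imgP[w wI ->].
have [e e0 eI] := cube_face_absorbing qI u_gt0 wI.
exists e; first by rewrite gt_eqF.
by exists (q + e *: w) => //; rewrite lfunE /= /cokpi [in LHS]linearD linearZ.
Qed.

(** Rank-nullity for [pi] on [W] and for [phi] on [phi^-1(W)], where [W] is the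
    coordinate space of [J]: the kernel in the first case and the image in the
    second are both [W cap im phi]. *)
Lemma dim_face_stratum S (L : set 'rV[R]_n) u :
  strata R v S -> is_lift S L -> L u ->
  (affine_dim (minimal_face (zonotope R v) (stratum_point S)) + stratum_dim S =
   k - #|J S| + \dim (lker phi :&: span_at L u))%N.
Proof.
move=> SS SL Lu; rewrite minimal_face_stratum_point // (stratum_dimE SL Lu).
have [c LE cS] := SL; rewrite -cS LE in Lu *.
rewrite affine_dim_cube_face; last by exists u.
rewrite span_fiber //; set I := J _.
have lker_cok : lker (linfun cok) = limg phi.
  apply/vspaceP => x; rewrite memv_ker lfunE /= -[x in RHS]subr0.
  by apply/eqP/vquot_eqP; rewrite /cokpi linear0.
rewrite -(dim_coord_space R) -(limg_ker_dim (linfun cok) (coord_space R I)).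
rewrite lker_cok.
rewrite -(limg_ker_dim phi (phi @^-1: _)) -lpreim_cap_limg lpreimK ?capvSr //.
by rewrite [(lker phi :&: _)%VS]capvC -[RHS]addnA addnA [LHS]addnC.
Qed.

End Strata.

Theorem theorem1 (R : realType) (n k : nat) (v : 'I_k -> 'rV[int]_n)
    (v_inj : injective v) :
  exists p : set (torus R v) -> coker R v,
    [/\ set_bij (strata R v) (lattice_points R v) p,
        forall S S' : set (torus R v), strata R v S -> strata R v S' ->
          J S = J S' ->
          minimal_face (zonotope R v) (p S) =
          minimal_face (zonotope R v) (p S'),
        forall S S' : set (torus R v), strata R v S -> strata R v S' ->
          J S \subset J S' ->
          minimal_face (zonotope R v) (p S') `<=`
          minimal_face (zonotope R v) (p S) &
        forall (S : set (torus R v)) (L : set 'rV[R]_n) (u : 'rV[R]_n),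
          strata R v S -> is_lift S L -> L u ->
          (affine_dim (minimal_face (zonotope R v) (p S)) + stratum_dim S =
           k - #|J S| + \dim (lker (phi R v) :&: span_at L u))%N].
Proof.
exists (@stratum_point R n k v); split.
- exact: stratum_point_bij.
- by move=> S S' SS SS' SJ; rewrite !minimal_face_stratum_point // SJ.
- move=> S S' SS SS' SJ; rewrite !minimal_face_stratum_point //.
  apply: image_subset => x [x01 /coord_spaceP x0]; split=> //.
  by apply/coord_spaceP => j /(fintype.subsetP SJ); exact: x0.
- exact: dim_face_stratum.
Qed.
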